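(* Suppose $(\mathbb P_n)_{n\ge0}$ is a family of orthogonal polynomials with respect to a weight $w(x,y)$ on $\Omega$, and let $z\in\mathbb C\setminus\Omega$. Then, for $n=1,2,\dots$, $$z\,\mathcal S_\Omega[\mathbb P_nw](z)=\mathcal S_\Omega[\zeta\,\mathbb P_nw](z),\qquad \zeta=x+iy.$$ In particular, if on $\Omega$ the $\mathbb P_n$ satisfy the recurrence relationships $$x\,\mathbb P_n=C_n^x\mathbb P_{n-1}+A_n^x\mathbb P_n+B_n^x\mathbb P_{n+1},\qquad y\,\mathbb P_n=C_n^y\mathbb P_{n-1}+A_n^y\mathbb P_n+B_n^y\mathbb P_{n+1},$$ with constant matrices of appropriate sizes, then for $A_n^z=A_n^x+iA_n^y$, $B_n^z=B_n^x+iB_n^y$, $C_n^z=C_n^x+iC_n^y$ we have, for $n=1,2,\dots$, $$z\,\mathcal S_\Omega[\mathbb P_nw](z)=C_n^z\,\mathcal S_\Omega[\mathbb P_{n-1}w](z)+A_n^z\,\mathcal S_\Omega[\mathbb P_nw](z)+B_n^z\,\mathcal S_\Omega[\mathbb P_{n+1}w](z).$$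
   Context: $\Omega=\{(x_1,1):x_1\in[0,1]\}\cup\{(1,x_2):x_2\in[0,1]\}$, viewed also as a subset of $\mathbb C$ by identifying $(x,y)$ with $x+iy$. The Stieltjes transform is $$\mathcal S_\Omega f(z)=\int_\Omega\frac{f(x,y)}{z-(x+iy)}\,ds,$$ with $ds$ the arc-length differential, applied entrywise to vectors. The weight $w$ is a nonnegative function on $\Omega$ whose restriction to each of the two segments has finite moments and positive integral. $\mathbb P_n$ is the column vector whose entries are a basis of the orthogonal polynomials of degree $n$ modulo $\langle(1-x)(1-y)\rangle$ (one entry for $n=0$, a constant; two entries for $n\ge1$), i.e. polynomials of degree at most $n$ orthogonal to all polynomials of lower degree with respect to $\int_\Omega fg\,w\,ds$. *)

(* Defs.v *)
From HB Require Import structures.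
From mathcomp Require Import all_boot all_order all_algebra.
From mathcomp Require Import all_classical all_reals all_analysis.
From mathcomp Require Import complex.
(* The notations of mpoly clash with those of mathcomp-analysis, so only its
   canonical instances and coercions are imported. *)
From mathcomp Require Import(canonicals, coercions) mpoly.

Set Implicit Arguments.
Unset Strict Implicit.
Unset Printing Implicit Defensive.

Import Order.TTheory GRing.Theory Num.Theory.

Local Open Scope classical_set_scope.
Local Open Scope ring_scope.
Local Open Scope complex_scope.

Notation bipoly R := (mpoly.mpoly 2 R).

Section Wedge.
Variable R : realType.

Definition toC (p : R * R) : R[i] := p.1 +i* p.2.

Definition Omega : set (R * R) :=
  [set (x, 1) | x in `[0, 1]] `|` [set (1, y) | y in `[0, 1]].

Definition OmegaC : set R[i] := toC @` Omega.

(* On each of the two segments the coordinate that varies is the arc length;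
   the corner (1, 1) they share is negligible. *)
Definition int_Omega (f : R * R -> R) : R :=
  \int[lebesgue_measure]_(x in `[0, 1]) f (x, 1) +
  \int[lebesgue_measure]_(y in `[0, 1]) f (1, y).

Definition int_OmegaC (f : R * R -> R[i]) : R[i] :=
  int_Omega (fun p => complex.Re (f p)) +i*
  int_Omega (fun p => complex.Im (f p)).

Definition stieltjes (f : R * R -> R[i]) (z : R[i]) : R[i] :=
  int_OmegaC (fun p => f p / (z - toC p)).

Definition stieltjes_mx m (f : R * R -> 'cV[R[i]]_m) (z : R[i]) :
    'cV[R[i]]_m :=
  \col_i stieltjes (fun p => f p i 0) z.

Definition segment_weight (u : R -> R) : Prop :=
  (forall k : nat, lebesgue_measure.-integrable `[0, 1]
     (fun t => (t ^+ k * u t)%:E)) /\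
  0 < \int[lebesgue_measure]_(t in `[0, 1]) u t.

Definition weight (w : R * R -> R) : Prop :=
  [/\ forall p, Omega p -> 0 <= w p,
      segment_weight (fun x => w (x, 1)) &
      segment_weight (fun y => w (1, y))].

Definition bieval (p : R * R) (f : bipoly R) : R :=
  mpoly.meval (fun i : 'I_2 => if i == 0 then p.1 else p.2) f.

Definition X1 : bipoly R := mpoly.mpolyX R (mpoly.mnm1 (0 : 'I_2)).
Definition X2 : bipoly R := mpoly.mpolyX R (mpoly.mnm1 (1 : 'I_2)).

Definition in_ideal (f : bipoly R) : Prop :=
  exists h : bipoly R, f = h * ((1 - X1) * (1 - X2)).

Definition ip (w : R * R -> R) (f g : bipoly R) : R :=
  int_Omega (fun p => bieval p f * bieval p g * w p).

(* [mpoly.msize f] is the total degree of f plus one, and is 0 for f = 0;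
   hence [mpoly.msize g <= n] says that g has degree less than n, and for
   n = 0 that g = 0. *)
Definition orthopoly (w : R * R -> R) (n : nat) (f : bipoly R) : Prop :=
  (mpoly.msize f <= n.+1)%N /\
  forall g : bipoly R, (mpoly.msize g <= n)%N -> ip w f g = 0.

Definition opdim (n : nat) : nat := if n is 0 then 1 else 2.

Record OP_family (w : R * R -> R) (P : forall n, 'cV[bipoly R]_(opdim n)) :
    Prop := {
  OP_orthopoly : forall n i, orthopoly w n (P n i 0);
  OP_free : forall n (c : 'I_(opdim n) -> R),
    in_ideal (\sum_i c i *: P n i 0) -> forall i, c i = 0;
  OP_span : forall n (f : bipoly R), orthopoly w n f ->
    exists c : 'I_(opdim n) -> R, in_ideal (f - \sum_i c i *: P n i 0) }.

Definition evalV m (P : 'cV[bipoly R]_m) (p : R * R) : 'cV[R]_m :=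
  map_mx (bieval p) P.

Definition mxC m n (A : 'M[R]_(m, n)) : 'M[R[i]]_(m, n) :=
  map_mx (real_complex R) A.

Definition weighted m (P : 'cV[bipoly R]_m) (w : R * R -> R) (p : R * R) :
    'cV[R[i]]_m :=
  mxC (w p *: evalV P p).

(* [coord] is one of the two coordinate functions; at n = 0 the term
   [P n.-1] is meaningless, so only 0 < n is constrained. *)
Definition recurrence (coord : R * R -> R)
    (P : forall n, 'cV[bipoly R]_(opdim n))
    (C : forall n, 'M[R]_(opdim n, opdim n.-1))
    (A : forall n, 'M[R]_(opdim n))
    (B : forall n, 'M[R]_(opdim n, opdim n.+1)) : Prop :=
  forall n, (0 < n)%N -> forall p, Omega p ->
    coord p *: evalV (P n) p =
    C n *m evalV (P n.-1) p + A n *m evalV (P n) p + B n *m evalV (P n.+1) p.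

Definition addi m n (A B : 'M[R]_(m, n)) : 'M[R[i]]_(m, n) :=
  mxC A + 'i%C *: mxC B.

End Wedge.

(* Main.v *)
Require Import Defs.
From mathcomp Require Import all_boot all_order all_algebra.
From mathcomp Require Import all_classical all_reals all_analysis.
From mathcomp Require Import complex.
From mathcomp Require Import measurable_realfun ring.
From mathcomp Require Import(canonicals, coercions) mpoly.

(** For [zeta = toC p] on the wedge, [z = (z - zeta) + zeta], so
      [z * (P w / (z - zeta)) = P w + zeta * (P w / (z - zeta))].
    Integrating, the two Stieltjes transforms of the first claim differ by the
    integral of [P w] ([stieltjes_mul_toC]), which is the inner product of [P]
    with the constant 1 and vanishes as soon as the degree of [P] is positive
    ([orthopoly_int0]).  For the second claim, adding [i] times the
    [y]-recurrence to the [x]-recurrence expresses [zeta P w] pointwise on the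
    wedge ([recurrence_toC]), and the transform commutes with constant complex
    matrices ([stieltjes_mxD], [stieltjes_mxM]).

    Every use of linearity needs the integrals to converge.  As [z] lies off
    the wedge, the real and imaginary parts of [1 / (z - zeta)] are continuous
    at each point of the wedge ([continuous_cauchy_kernel]), hence bounded on
    both segments, while the weight is integrable; so polynomial times kernel
    times weight is integrable ([weight_integrable],
    [weight_poly_stieltjes_integrable]). *)

Set Implicit Arguments.
Unset Strict Implicit.
Unset Printing Implicit Defensive.

Import Order.TTheory GRing.Theory Num.Theory.
Import numFieldNormedType.Exports.

Local Open Scope classical_set_scope.
Local Open Scope ring_scope.
Local Open Scope complex_scope.

Section StieltjesOnWedge.
Variable R : realType.
Notation mu := (@lebesgue_measure R).
Implicit Types (p : R * R) (f g : R * R -> R) (F G : R * R -> R[i]).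

(** * Real integrals over the wedge *)

Definition Omega_integrable f : Prop :=
  mu.-integrable `[0, 1] (fun t => (f (t, 1))%:E) /\
  mu.-integrable `[0, 1] (fun t => (f (1, t))%:E).

Lemma Omega_horizontal (t : R) : `[0, 1]%classic t -> Omega (t, 1).
Proof. by move=> t01; left; exists t. Qed.

Lemma Omega_vertical (t : R) : `[0, 1]%classic t -> Omega (1, t).
Proof. by move=> t01; right; exists t. Qed.

(** The integrals see only the values on the wedge, which is what allows
    pointwise identities whose denominators vanish elsewhere in the plane. *)
Lemma eq_int_Omega f g : (forall p, Omega p -> f p = g p) ->
  int_Omega f = int_Omega g.
Proof.
move=> fg; rewrite /int_Omega; congr (_ + _); apply: eq_Rintegral => t;
  rewrite inE => t01; apply: fg;
  [exact: Omega_horizontal | exact: Omega_vertical].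
Qed.

Lemma eq_Omega_integrable f g : (forall p, Omega p -> f p = g p) ->
  Omega_integrable f -> Omega_integrable g.
Proof.
by move=> fg [f1 f2]; split; [move: f1|move: f2]; apply: eq_integrable => // t;
  rewrite inE => t01; rewrite fg //;
  [exact: Omega_horizontal | exact: Omega_vertical].
Qed.

Lemma Omega_integrableD f g : Omega_integrable f -> Omega_integrable g ->
  Omega_integrable (fun p => f p + g p).
Proof. by move=> [f1 f2] [g1 g2]; split;
  [apply: eq_integrable (integrableD _ f1 g1)|
   apply: eq_integrable (integrableD _ f2 g2)]. Qed.

Lemma Omega_integrableZ (c : R) f : Omega_integrable f ->
  Omega_integrable (fun p => c * f p).
Proof. by move=> [f1 f2]; split;
  [apply: eq_integrable (integrableZl _ c f1)|
   apply: eq_integrable (integrableZl _ c f2)]. Qed.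

Lemma int_OmegaD f g : Omega_integrable f -> Omega_integrable g ->
  int_Omega (fun p => f p + g p) = int_Omega f + int_Omega g.
Proof.
by move=> [f1 f2] [g1 g2]; rewrite /int_Omega !RintegralD//; ring.
Qed.

Lemma int_OmegaZ (c : R) f : Omega_integrable f ->
  int_Omega (fun p => c * f p) = c * int_Omega f.
Proof. by move=> [f1 f2]; rewrite /int_Omega !RintegralZl// mulrDr. Qed.

Lemma Omega_integrable0 : Omega_integrable (fun=> 0).
Proof. by split; exact: integrable0. Qed.

Lemma int_Omega0 : int_Omega (fun=> 0) = 0 :> R.
Proof. by have := int_OmegaZ 0 Omega_integrable0; rewrite !mul0r. Qed.

(** A function continuous on the compact segment is bounded and measurable
    there, and the moment of order 0 says that the weight is integrable. *)
Lemma segment_weight_integrable (u h : R -> R) :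
  segment_weight u -> (forall t, `[0, 1]%classic t -> {for t, continuous h}) ->
  mu.-integrable `[0, 1] (fun t => (h t * u t)%:E).
Proof.
move=> [/(_ 0%N) iu _] ch.
have cw : {within `[0, 1], continuous h}.
  by apply: continuous_in_subspaceT => t; rewrite inE; exact: ch.
have := @integrableMr _ _ _ mu `[0, 1] _ h (fun t => (u t)%:E).
apply => //.
- exact: subspace_continuous_measurable_fun.
- have /compact_bounded [M [Mr hM]] :=
    continuous_compact cw (@segment_compact R 0 1).
  by exists M; split => // N MN t /= t01; apply: hM MN _ _; exists t.
- by apply: eq_integrable iu => // t _; rewrite expr0 mul1r.
Qed.

Lemma continuous_on_lines (h : R * R -> R) (t : R) :
  ({for (t, 1), continuous h} -> {for t, continuous (fun s => h (s, 1))}) /\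
  ({for (1, t), continuous h} -> {for t, continuous (fun s => h (1, s))}).
Proof.
split=> ch.
  have ct : {for t, continuous (fun s : R => (s, 1 : R))}.
    exact: (cvg_pair (@cvg_id _ _) (cvg_cst _)).
  exact: (continuous_comp ct ch).
have ct : {for t, continuous (fun s : R => (1 : R, s))}.
  exact: (cvg_pair (cvg_cst _) (@cvg_id _ _)).
exact: (continuous_comp ct ch).
Qed.

Lemma weight_integrable (w h : R * R -> R) :
  weight w -> (forall p, Omega p -> {for p, continuous h}) ->
  Omega_integrable (fun p => h p * w p).
Proof.
move=> [_ w1 w2] ch; split; [apply: (segment_weight_integrable w1)|
  apply: (segment_weight_integrable w2)] => t t01.
- exact: (continuous_on_lines h t).1 (ch _ (Omega_horizontal t01)).
- exact: (continuous_on_lines h t).2 (ch _ (Omega_vertical t01)).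
Qed.

(** * Complex integrals over the wedge *)

Definition OmegaC_integrable F : Prop :=
  Omega_integrable (fun p => complex.Re (F p)) /\
  Omega_integrable (fun p => complex.Im (F p)).

Lemma eq_int_OmegaC F G : (forall p, Omega p -> F p = G p) ->
  int_OmegaC F = int_OmegaC G.
Proof.
by move=> FG; rewrite /int_OmegaC; congr (_ +i* _);
  apply: eq_int_Omega => p /FG ->.
Qed.

Lemma OmegaC_integrableD F G : OmegaC_integrable F -> OmegaC_integrable G ->
  OmegaC_integrable (fun p => F p + G p).
Proof.
move=> [F1 F2] [G1 G2].
by split; [move: (Omega_integrableD F1 G1)|move: (Omega_integrableD F2 G2)];
  apply: eq_Omega_integrable => p _; case: (F p) (G p) => a b [].
Qed.

Lemma OmegaC_integrableZ (c : R[i]) F : OmegaC_integrable F ->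
  OmegaC_integrable (fun p => c * F p).
Proof.
case: c => a b [F1 F2]; split.
  move: (Omega_integrableD (Omega_integrableZ a F1)
                           (Omega_integrableZ (- b) F2)).
  by apply: eq_Omega_integrable => p _; case: (F p) => x y /=; rewrite mulNr.
move: (Omega_integrableD (Omega_integrableZ a F2) (Omega_integrableZ b F1)).
by apply: eq_Omega_integrable => p _; case: (F p).
Qed.

Lemma int_OmegaCD F G : OmegaC_integrable F -> OmegaC_integrable G ->
  int_OmegaC (fun p => F p + G p) = int_OmegaC F + int_OmegaC G.
Proof.
move=> [F1 F2] [G1 G2]; rewrite /int_OmegaC [RHS]/GRing.add/=.
congr (_ +i* _); rewrite -int_OmegaD//; apply: eq_int_Omega => p _;
  by case: (F p) (G p) => a b [].
Qed.

Lemma int_OmegaCZ (c : R[i]) F : OmegaC_integrable F ->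
  int_OmegaC (fun p => c * F p) = c * int_OmegaC F.
Proof.
case: c => a b [F1 F2]; rewrite /int_OmegaC [RHS]/GRing.mul/=.
congr (_ +i* _).
  rewrite -mulNr -!int_OmegaZ// -int_OmegaD; [|exact: Omega_integrableZ..].
  by apply: eq_int_Omega => p _; case: (F p) => x y /=; rewrite mulNr.
rewrite -!int_OmegaZ// -int_OmegaD; [|exact: Omega_integrableZ..].
by apply: eq_int_Omega => p _; case: (F p).
Qed.

Lemma int_OmegaC_real f : int_OmegaC (fun p => (f p)%:C) = (int_Omega f)%:C.
Proof. by rewrite /int_OmegaC /= int_Omega0. Qed.

Lemma OmegaC_integrable_real f :
  Omega_integrable f -> OmegaC_integrable (fun p => (f p)%:C).
Proof. by split => //=; exact: Omega_integrable0. Qed.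

Lemma OmegaC_integrable_sum (I : Type) (r : seq I) (Fs : I -> R * R -> R[i]) :
  (forall j, OmegaC_integrable (Fs j)) ->
  OmegaC_integrable (fun p => \sum_(j <- r) Fs j p).
Proof.
move=> iF; elim: r => [|j r IHr].
  under [X in OmegaC_integrable X]funext do rewrite big_nil.
  exact: OmegaC_integrable_real Omega_integrable0.
under [X in OmegaC_integrable X]funext do rewrite big_cons.
exact: OmegaC_integrableD.
Qed.

Lemma int_OmegaC_sum (I : Type) (r : seq I) (Fs : I -> R * R -> R[i]) :
  (forall j, OmegaC_integrable (Fs j)) ->
  int_OmegaC (fun p => \sum_(j <- r) Fs j p) = \sum_(j <- r) int_OmegaC (Fs j).
Proof.
move=> iF; elim: r => [|j r IHr].
  under [X in int_OmegaC X]funext do rewrite big_nil.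
  by rewrite big_nil (int_OmegaC_real (fun=> 0)) int_Omega0.
under [X in int_OmegaC X]funext do rewrite big_cons.
by rewrite big_cons int_OmegaCD ?IHr//; exact: OmegaC_integrable_sum.
Qed.

(** * Polynomials and the Cauchy kernel *)

Lemma continuous_bieval (f : bipoly R) : continuous (fun p => bieval p f).
Proof.
move=> p; apply: cvg_big => [|m _].
  exact: pseudometric_normed_Zmodule.add_continuous.
apply: cvgMr.
apply: cvg_big => [|i _]; first exact: mul_continuous.
apply: (@continuous_comp (R * R)%type R R
  (fun q => if i == 0 then q.1 else q.2) (fun x => x ^+ _)); last first.
  exact: exprn_continuous.
by case: (i == 0); [exact: cvg_fst|exact: cvg_snd].
Qed.

(** With [z = a + ib] and [q = (x, y)], the inverse of [z - toC q] has parts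
    [(a - x) / N] and [- (b - y) / N], where [N = (a - x)^2 + (b - y)^2] does
    not vanish when [z] is not [toC q]. *)
Lemma continuous_cauchy_kernel (z : R[i]) p : z != toC p ->
  {for p, continuous (fun q => complex.Re (z - toC q)^-1)} /\
  {for p, continuous (fun q => complex.Im (z - toC q)^-1)}.
Proof.
case: z => a b; case: p => x y zp.
have cx : {for (x, y), continuous (fun q : R * R => a - q.1)}.
  by apply: continuousB; [exact: cst_continuous|exact: cvg_fst].
have cy : {for (x, y), continuous (fun q : R * R => b - q.2)}.
  by apply: continuousB; [exact: cst_continuous|exact: cvg_snd].
have cn : {for (x, y), continuous
    (fun q : R * R => ((a - q.1) * (a - q.1) + (b - q.2) * (b - q.2))^-1)}.
  apply: continuousV; last by apply: continuousD; apply: continuousM.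
  rewrite /= -!expr2 paddr_eq0 ?sqr_ge0// !sqrf_eq0 !subr_eq0.
  by move: zp; rewrite eq_complex.
split; first exact: continuousM cx cn.
by apply: continuousN; apply: continuousM cy cn.
Qed.

Lemma OmegaC_notin (z : R[i]) p : ~ OmegaC z -> Omega p -> z != toC p.
Proof. by move=> zO Op; apply/eqP => zp; apply: zO; exists p. Qed.

Lemma weight_poly_integrable (w : R * R -> R) (f : bipoly R) : weight w ->
  OmegaC_integrable (fun p => (w p * bieval p f)%:C).
Proof.
move=> ww; apply: OmegaC_integrable_real.
apply: eq_Omega_integrable (weight_integrable (h := fun p => bieval p f) ww _).
  by move=> p _; rewrite mulrC.
by move=> p _; exact: continuous_bieval.
Qed.

Definition stieltjes_integrable (z : R[i]) F : Prop :=
  OmegaC_integrable (fun p => F p / (z - toC p)).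

Lemma weight_poly_stieltjes_integrable (w : R * R -> R) (f : bipoly R) z :
  weight w -> ~ OmegaC z ->
  stieltjes_integrable z (fun p => (w p * bieval p f)%:C).
Proof.
move=> ww zO; split.
  apply: (@eq_Omega_integrable
    (fun p => bieval p f * complex.Re (z - toC p)^-1 * w p)).
    by move=> p _; case: ((z - toC p)^-1) => a b /=; ring.
  apply: weight_integrable => // p Op; apply: continuousM.
    exact: continuous_bieval.
  exact: (continuous_cauchy_kernel (OmegaC_notin zO Op)).1.
apply: (@eq_Omega_integrable
  (fun p => bieval p f * complex.Im (z - toC p)^-1 * w p)).
  by move=> p _; case: ((z - toC p)^-1) => a b /=; ring.
apply: weight_integrable => // p Op; apply: continuousM.
  exact: continuous_bieval.
exact: (continuous_cauchy_kernel (OmegaC_notin zO Op)).2.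
Qed.

(** Pointwise, [toC p / (z - toC p) = z / (z - toC p) - 1]; this needs [z] off
    the wedge. *)
Lemma stieltjes_mul_toC (z : R[i]) F : ~ OmegaC z ->
  OmegaC_integrable F -> stieltjes_integrable z F ->
  stieltjes (fun p => toC p * F p) z = z * stieltjes F z - int_OmegaC F.
Proof.
move=> zO iF sF; rewrite /stieltjes -int_OmegaCZ// -[- _]mulN1r -int_OmegaCZ//.
rewrite -int_OmegaCD; [|exact: OmegaC_integrableZ..].
apply: eq_int_OmegaC => p Op; rewrite mulN1r.
have zp : z - toC p != 0 by rewrite subr_eq0 OmegaC_notin.
by field.
Qed.

(** The integral against the weight is the inner product with the constant
    polynomial 1, whose degree 0 is less than [n]. *)
Lemma orthopoly_int0 (w : R * R -> R) n (f : bipoly R) : (0 < n)%N ->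
  orthopoly w n f -> int_OmegaC (fun p => (w p * bieval p f)%:C) = 0.
Proof.
move=> n0 [_ orth]; rewrite int_OmegaC_real.
have /orth : (mpoly.msize (1 : bipoly R) <= n)%N by rewrite mpoly.msize1.
move=> ip1; suff -> : int_Omega (fun p => w p * bieval p f) = 0 by [].
rewrite -[RHS]ip1; apply: eq_int_Omega => p _.
by rewrite [bieval p 1]mpoly.meval1; ring.
Qed.

Lemma weightedE m (Q : 'cV[bipoly R]_m) (w : R * R -> R) p i :
  weighted Q w p i 0 = (w p * bieval p (Q i 0))%:C.
Proof. by rewrite !mxE. Qed.

(** * Vectors of Stieltjes transforms *)

Section Matrices.
Variables (z : R[i]).

Definition stieltjes_mx_integrable m (F : R * R -> 'cV[R[i]]_m) : Prop :=
  forall i, stieltjes_integrable z (fun p => F p i 0).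

Lemma eq_stieltjes_mx m (F G : R * R -> 'cV[R[i]]_m) :
  (forall p, Omega p -> F p = G p) -> stieltjes_mx F z = stieltjes_mx G z.
Proof.
by move=> FG; apply/colP => i; rewrite !mxE; apply: eq_int_OmegaC => p /FG ->.
Qed.

Lemma stieltjes_mx_integrableD m (F G : R * R -> 'cV[R[i]]_m) :
  stieltjes_mx_integrable F -> stieltjes_mx_integrable G ->
  stieltjes_mx_integrable (fun p => F p + G p).
Proof.
move=> iF iG i; rewrite /stieltjes_integrable.
under [X in OmegaC_integrable X]funext do rewrite mxE mulrDl.
exact: OmegaC_integrableD (iF i) (iG i).
Qed.

Lemma stieltjes_mxD m (F G : R * R -> 'cV[R[i]]_m) :
  stieltjes_mx_integrable F -> stieltjes_mx_integrable G ->
  stieltjes_mx (fun p => F p + G p) z = stieltjes_mx F z + stieltjes_mx G z.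
Proof.
move=> iF iG; apply/colP => i; rewrite !mxE /stieltjes -int_OmegaCD;
  [|exact: iF|exact: iG].
by apply: eq_int_OmegaC => p _; rewrite mxE mulrDl.
Qed.

Lemma mulmx_entry m n (M : 'M[R[i]]_(m, n)) (F : R * R -> 'cV[R[i]]_n) i p :
  (M *m F p) i 0 / (z - toC p) = \sum_j M i j * (F p j 0 / (z - toC p)).
Proof. by rewrite mxE mulr_suml; apply: eq_bigr => j _; rewrite mulrA. Qed.

Lemma stieltjes_mx_integrableM m n (M : 'M[R[i]]_(m, n))
    (F : R * R -> 'cV[R[i]]_n) :
  stieltjes_mx_integrable F -> stieltjes_mx_integrable (fun p => M *m F p).
Proof.
move=> iF i; rewrite /stieltjes_integrable.
under [X in OmegaC_integrable X]funext do rewrite mulmx_entry.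
by apply: OmegaC_integrable_sum => j; exact: OmegaC_integrableZ (iF j).
Qed.

Lemma stieltjes_mxM m n (M : 'M[R[i]]_(m, n)) (F : R * R -> 'cV[R[i]]_n) :
  stieltjes_mx_integrable F ->
  stieltjes_mx (fun p => M *m F p) z = M *m stieltjes_mx F z.
Proof.
move=> iF; apply/colP => i; rewrite !mxE /stieltjes.
under [X in int_OmegaC X]funext do rewrite mulmx_entry.
rewrite int_OmegaC_sum => [|j]; last exact: OmegaC_integrableZ (iF j).
by apply: eq_bigr => j _; rewrite mxE int_OmegaCZ//; exact: iF.
Qed.

Lemma weighted_integrable (w : R * R -> R) m (Q : 'cV[bipoly R]_m) :
  weight w -> ~ OmegaC z -> stieltjes_mx_integrable (weighted Q w).
Proof.
move=> ww zO i; rewrite /stieltjes_integrable.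
under [X in OmegaC_integrable X]funext do rewrite weightedE.
exact: weight_poly_stieltjes_integrable.
Qed.

End Matrices.

Lemma mxC_mulmx m n k (A : 'M[R]_(m, n)) (B : 'M[R]_(n, k)) :
  mxC (A *m B) = mxC A *m mxC B.
Proof. exact: map_mxM. Qed.

(** The [x]-recurrence plus [i] times the [y]-recurrence.  As these hold only
    at points of the wedge, so does the result: it is not an identity between
    polynomials. *)
Lemma recurrence_toC (w : R * R -> R) P Cx Ax Bx Cy Ay By n p :
  recurrence (fun p : R * R => p.1) P Cx Ax Bx ->
  recurrence (fun p : R * R => p.2) P Cy Ay By ->
  (0 < n)%N -> Omega p ->
  toC p *: weighted (P n) w p =
    addi (Cx n) (Cy n) *m weighted (P n.-1) w p +
    addi (Ax n) (Ay n) *m weighted (P n) w p +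
    addi (Bx n) (By n) *m weighted (P n.+1) w p.
Proof.
move=> rx ry n0 Op.
have lift coord C A B : recurrence coord P C A B ->
    (coord p)%:C *: weighted (P n) w p =
    mxC (C n) *m weighted (P n.-1) w p + mxC (A n) *m weighted (P n) w p +
    mxC (B n) *m weighted (P n.+1) w p.
  move=> /(_ n n0 p Op) e.
  rewrite /weighted -!mxC_mulmx -!scalemxAr /mxC -!map_mxD -!scalerDr -e.
  by rewrite -map_mxZ /= scalerA mulrC -scalerA.
have -> : toC p = (p.1)%:C + 'i%C * (p.2)%:C.
  by rewrite mulrC -complexr0 /toC; simpc.
rewrite scalerDl -scalerA (lift _ _ _ _ rx) (lift _ _ _ _ ry) /addi !mulmxDl.
by rewrite -!scalemxAl !scalerDr addrACA; congr (_ + _); rewrite addrACA.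
Qed.

End StieltjesOnWedge.

Theorem propositionB1 (R : realType) (w : R * R -> R)
    (P : forall n : nat, 'cV[bipoly R]_(opdim n)) (z : R[i]) :
  weight w -> OP_family w P -> ~ OmegaC z ->
  (forall n : nat, (0 < n)%N ->
     z *: stieltjes_mx (weighted (P n) w) z =
     stieltjes_mx (fun p => toC p *: weighted (P n) w p) z) /\
  (forall (Cx Cy : forall n : nat, 'M[R]_(opdim n, opdim n.-1))
          (Ax Ay : forall n : nat, 'M[R]_(opdim n))
          (Bx By : forall n : nat, 'M[R]_(opdim n, opdim n.+1)),
     recurrence (fun p => p.1) P Cx Ax Bx ->
     recurrence (fun p => p.2) P Cy Ay By ->
     forall n : nat, (0 < n)%N ->
       z *: stieltjes_mx (weighted (P n) w) z =
       addi (Cx n) (Cy n) *m stieltjes_mx (weighted (P n.-1) w) z +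
       addi (Ax n) (Ay n) *m stieltjes_mx (weighted (P n) w) z +
       addi (Bx n) (By n) *m stieltjes_mx (weighted (P n.+1) w) z).
Proof.
move=> ww opP zO.
have shift n : (0 < n)%N -> z *: stieltjes_mx (weighted (P n) w) z =
    stieltjes_mx (fun p => toC p *: weighted (P n) w p) z.
  move=> n0; apply/colP => i; rewrite !mxE.
  under [X in stieltjes X z]funext do rewrite weightedE.
  under [X in _ = stieltjes X z]funext do rewrite mxE weightedE.
  rewrite stieltjes_mul_toC//; last first.
  - exact: weight_poly_stieltjes_integrable.
  - exact: weight_poly_integrable.
  by rewrite (orthopoly_int0 n0 (@OP_orthopoly _ _ _ opP n i)) subr0.
split=> // Cx Cy Ax Ay Bx By rx ry n n0; rewrite shift//.
rewrite (eq_stieltjes_mx z (fun p Op => recurrence_toC w rx ry n0 Op)).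
have iw k := weighted_integrable (P k) ww zO.
have iM k m (M : 'M[R[i]]_(m, opdim k)) := stieltjes_mx_integrableM M (iw k).
rewrite stieltjes_mxD; [|exact: stieltjes_mx_integrableD|exact: iM].
by rewrite stieltjes_mxD ?stieltjes_mxM.
Qed.
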